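(* Let $G$ be the single-layer ReLU network, $w_0\in\mathbb{R}^m$, $\varepsilon>0$, $z_0=G(w_0)$, and let $L_{w_0,\varepsilon}$ and the semidefinite program (D) with optimal value $\gamma_{\mathrm{dual}}^2$ ($\gamma_{\mathrm{dual}}\ge 0$) be as defined in the context. Suppose that $H\in\mathbb{S}_+^{1+m+n}$ is an optimal solution of (D) with $\mathrm{rank}(H)=1$. Then: (1) $L_{w_0,\varepsilon}=\gamma_{\mathrm{dual}}$. (2) $H$ has a full-rank factorization of the form $$H=\begin{bmatrix}1\\ h_2\\ h_3\end{bmatrix}\begin{bmatrix}1\\ h_2\\ h_3\end{bmatrix}^T,\qquad h_2\in\mathbb{R}^m,\ h_3\in\mathbb{R}^n.$$ (3) With $w^\star:=h_2$, one has $w^\star\in\mathcal{B}_\varepsilon(w_0)$, and $w^\star$ is a worst-case input, i.e. $L_{w_0,\varepsilon}=|G(w^\star)-G(w_0)|_2$.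
   Context: Network: $G:\mathbb{R}^m\to\mathbb{R}^l$, $G(w)=W_{\mathrm{out}}\Phi(W_{\mathrm{in}}w+b_{\mathrm{in}})$, with $W_{\mathrm{in}}\in\mathbb{R}^{n\times m}$, $W_{\mathrm{out}}\in\mathbb{R}^{l\times n}$, $b_{\mathrm{in}}\in\mathbb{R}^n$ (the output bias is taken to be zero), where $\Phi(q)=(\max(q_1,0),\dots,\max(q_n,0))^T$ is the entrywise ReLU. $|\cdot|_2$ is the Euclidean norm and $\mathcal{B}_\varepsilon(w_0)=\{w\in\mathbb{R}^m:|w-w_0|_2\le\varepsilon\}$. The local Lipschitz constant at the target input $w_0$ is defined as $$L_{w_0,\varepsilon}=\min\{L:\ |G(w)-G(w_0)|_2\le L\ \text{ for all } w\in\mathcal{B}_\varepsilon(w_0)\}.$$ $\mathbb{S}_+^k$ denotes the set of real symmetric positive semidefinite $k\times k$ matrices. Partition $$H=\begin{bmatrix}H_{11}&H_{12}&H_{13}\\ H_{12}^T&H_{22}&H_{23}\\ H_{13}^T&H_{23}^T&H_{33}\end{bmatrix}\in\mathbb{S}_+^{1+m+n},\quad H_{11}\in\mathbb{R},\ H_{22}\in\mathbb{S}_+^m,\ H_{33}\in\mathbb{S}_+^n.$$ For a square matrix $A$, $\mathrm{diag}(A)$ denotes the vector of its diagonal entries; for a matrix $A$, $A\ge 0$ means entrywise nonnegativity. Semidefinite program (D): $$\gamma_{\mathrm{dual}}^2=\sup_{H\in\mathbb{S}_+^{1+m+n}}\ \mathrm{trace}(V^THV),\qquad V=\begin{bmatrix}z_0^T\\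 0_{m,l}\\ -W_{\mathrm{out}}^T\end{bmatrix},$$ subject to (a) $H_{11}=1$; (b) $\mathrm{trace}\left(\begin{bmatrix}\varepsilon^2-w_0^Tw_0&w_0^T\\ w_0&-I_m\end{bmatrix}\begin{bmatrix}H_{11}&H_{12}\\ H_{12}^T&H_{22}\end{bmatrix}\right)\ge 0$; (c) $\mathrm{diag}(-b_{\mathrm{in}}H_{13}-W_{\mathrm{in}}H_{23}+H_{33})=0$; (d) $FHF^T\ge 0$ entrywise, where $F=\begin{bmatrix}1&0_{1,m}&0_{1,n}\\ -b_{\mathrm{in}}&-W_{\mathrm{in}}&I_n\\ 0_{n,1}&0_{n,m}&I_n\end{bmatrix}$. *)

(* Defs.v *)
From HB Require Import structures.
From mathcomp Require Import all_boot all_order all_algebra.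
From mathcomp Require Import boolp classical_sets reals ereal constructive_ereal.
Set Implicit Arguments.
Unset Strict Implicit.
Unset Printing Implicit Defensive.
Import Order.TTheory GRing.Theory Num.Theory.
Local Open Scope classical_set_scope.
Local Open Scope ring_scope.

(* The norm MathComp-Analysis puts on matrices is the max norm, hence a
   separate Euclidean norm. *)
Definition norm2 (R : realType) (k : nat) (v : 'cV[R]_k) : R :=
  Num.sqrt (\sum_(i < k) v i 0 ^+ 2).

Definition cball2 (R : realType) (k : nat) (c : 'cV[R]_k) (e : R) :
    set 'cV[R]_k :=
  [set v | norm2 (v - c) <= e].

Definition relu (R : realType) (k : nat) (q : 'cV[R]_k) : 'cV[R]_k :=
  map_mx (fun x => Num.max x 0) q.

Definition network (R : realType) (m n l : nat) (Win : 'M[R]_(n, m))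
    (bin : 'cV[R]_n) (Wout : 'M[R]_(l, n)) (w : 'cV[R]_m) : 'cV[R]_l :=
  Wout *m relu (Win *m w + bin).

Definition lipschitz_bounds (R : realType) (m l : nat)
    (G : 'cV[R]_m -> 'cV[R]_l) (w0 : 'cV[R]_m) (e : R) : set R :=
  [set L | forall w, cball2 w0 e w -> norm2 (G w - G w0) <= L].

(* For a network the infimum is a minimum: see local_lipschitz_min. *)
Definition local_lipschitz (R : realType) (m l : nat)
    (G : 'cV[R]_m -> 'cV[R]_l) (w0 : 'cV[R]_m) (e : R) : R :=
  inf (lipschitz_bounds G w0 e).

Definition psd (R : realType) (k : nat) (A : 'M[R]_k) : Prop :=
  A^T = A /\ forall x : 'cV[R]_k, 0 <= (x^T *m A *m x) 0 0.

Definition mx_ge0 (R : realType) (p q : nat) (A : 'M[R]_(p, q)) : Prop :=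
  forall i j, 0 <= A i j.

(* 'I_(1 + m + n) parses as 'I_((1 + m) + n), so the 3 x 3 partition is a
   2 x 2 partition whose upper left block is itself partitioned. *)
Section Blocks.
Context {R : realType} {m n : nat}.
Implicit Type H : 'M[R]_(1 + m + n).

Definition H11 H : 'M[R]_1 := ulsubmx (ulsubmx H).
Definition H12 H : 'M[R]_(1, m) := ursubmx (ulsubmx H).
Definition H22 H : 'M[R]_m := drsubmx (ulsubmx H).
Definition H13 H : 'M[R]_(1, n) := usubmx (ursubmx H).
Definition H23 H : 'M[R]_(m, n) := dsubmx (ursubmx H).
Definition H33 H : 'M[R]_n := drsubmx H.
End Blocks.

Definition dual_V (R : realType) (m n l : nat) (Wout : 'M[R]_(l, n))
    (z0 : 'cV[R]_l) : 'M[R]_(1 + m + n, l) :=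
  col_mx (col_mx z0^T 0) (- Wout^T).

Definition dual_F (R : realType) (m n : nat) (Win : 'M[R]_(n, m))
    (bin : 'cV[R]_n) : 'M[R]_(1 + n + n, 1 + m + n) :=
  block_mx (block_mx 1%:M 0 (- bin) (- Win)) (col_mx 0 1%:M)
           (row_mx 0 0)                      1%:M.

Definition dual_objective (R : realType) (m n l : nat) (Wout : 'M[R]_(l, n))
    (z0 : 'cV[R]_l) (H : 'M[R]_(1 + m + n)) : R :=
  let V := dual_V m Wout z0 in \tr (V^T *m H *m V).

Definition dual_feasible (R : realType) (m n : nat) (Win : 'M[R]_(n, m))
    (bin : 'cV[R]_n) (w0 : 'cV[R]_m) (e : R) : set 'M[R]_(1 + m + n) :=
  [set H |
    [/\ psd H,
        H11 H = 1%:M,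
        0 <= \tr (block_mx ((e ^+ 2)%:M - w0^T *m w0) w0^T
                           w0                         (- 1%:M)
                  *m block_mx (H11 H)    (H12 H)
                              (H12 H)^T  (H22 H)),
        forall i, (- bin *m H13 H - Win *m H23 H + H33 H) i i = 0
      & let F := dual_F Win bin in mx_ge0 (F *m H *m F^T)]].

Definition dual_optimal (R : realType) (m n l : nat) (Win : 'M[R]_(n, m))
    (bin : 'cV[R]_n) (Wout : 'M[R]_(l, n)) (w0 : 'cV[R]_m) (e : R)
    (z0 : 'cV[R]_l) (H : 'M[R]_(1 + m + n)) : Prop :=
  dual_feasible Win bin w0 e H /\
  forall H', dual_feasible Win bin w0 e H' ->
    dual_objective Wout z0 H' <= dual_objective Wout z0 H.

Definition dual_value (R : realType) (m n l : nat) (Win : 'M[R]_(n, m))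
    (bin : 'cV[R]_n) (Wout : 'M[R]_(l, n)) (w0 : 'cV[R]_m) (e : R)
    (z0 : 'cV[R]_l) : \bar R :=
  ereal_sup [set (dual_objective Wout z0 H)%:E
            | H in dual_feasible Win bin w0 e].

Definition gamma_dual (R : realType) (m n l : nat) (Win : 'M[R]_(n, m))
    (bin : 'cV[R]_n) (Wout : 'M[R]_(l, n)) (w0 : 'cV[R]_m) (e : R)
    (z0 : 'cV[R]_l) : \bar R :=
  sqrte (dual_value Win bin Wout w0 e z0).

Definition full_rank_factorization (R : realType) (p q r : nat)
    (A : 'M[R]_(p, q)) (B : 'M[R]_(p, r)) (C : 'M[R]_(r, q)) : Prop :=
  [/\ A = B *m C, \rank B = r & \rank C = r].

Section LocalLipschitzMin.
Variable R : realType.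

Lemma le_norm2 k (v : 'cV[R]_k) i : `|v i 0| <= norm2 v.
Proof.
rewrite -sqrtr_sqr ler_wsqrtr// (bigD1 i)//= lerDl.
by apply: sumr_ge0 => j _; exact: sqr_ge0.
Qed.

Lemma norm2_le_sum k (v : 'cV[R]_k) : norm2 v <= \sum_i `|v i 0|.
Proof.
have s0 : 0 <= \sum_i `|v i 0| by apply: sumr_ge0.
rewrite -[leRHS]ger0_norm// -sqrtr_sqr ler_wsqrtr// expr2 mulr_suml.
apply: ler_sum => i _; rewrite -real_normK ?num_real// expr2 ler_wpM2l//.
by rewrite (bigD1 i)//= lerDl sumr_ge0.
Qed.

Lemma ler_norm_mulmx p q (A : 'M[R]_(p, q)) (v : 'cV[R]_q) (u : 'I_q -> R) i :
  (forall j, `|v j 0| <= u j) -> `|(A *m v) i 0| <= \sum_j `|A i j| * u j.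
Proof.
move=> vu; rewrite mxE (le_trans (ler_norm_sum _ _ _))//.
by apply: ler_sum => j _; rewrite normrM ler_wpM2l.
Qed.

Lemma lipschitz_bounds_neq0 m n l (Win : 'M[R]_(n, m)) (bin : 'cV[R]_n)
    (Wout : 'M[R]_(l, n)) (w0 : 'cV[R]_m) (e : R) :
  lipschitz_bounds (network Win bin Wout) w0 e !=set0.
Proof.
pose G := network Win bin Wout.
pose a i := \sum_j `|Win i j| * (e + `|w0 j 0|) + `|bin i 0|.
exists (\sum_k (\sum_i `|Wout k i| * a i + `|G w0 k 0|)) => w /= wB.
apply: (le_trans (norm2_le_sum _)); apply: ler_sum => k _.
rewrite mxE [X in _ + X]mxE (le_trans (ler_normB _ _))// lerD2r.
apply: ler_norm_mulmx => i; rewrite mxE.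
have -> (x : R) : (`|Num.max x 0| <= a i) = (Num.max x 0 <= a i).
  by rewrite ger0_norm// le_max lexx orbT.
rewrite mxE ge_max; apply/andP; split.
  rewrite (le_trans (ler_norm _))// (le_trans (ler_normD _ _))// lerD2r.
  apply: ler_norm_mulmx => j; rewrite -[w j 0](subrK (w0 j 0)).
  rewrite (le_trans (ler_normD _ _))// lerD2r (le_trans _ wB)//.
  by have := le_norm2 (w - w0) j; rewrite !mxE.
rewrite addr_ge0// sumr_ge0// => j _; rewrite mulr_ge0// addr_ge0//.
by rewrite (le_trans _ wB)// sqrtr_ge0.
Qed.

Lemma local_lipschitz_min m n l (Win : 'M[R]_(n, m)) (bin : 'cV[R]_n)
    (Wout : 'M[R]_(l, n)) (w0 : 'cV[R]_m) (e : R) :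
  0 <= e ->
  let S := lipschitz_bounds (network Win bin Wout) w0 e in
  S (local_lipschitz (network Win bin Wout) w0 e) /\
  lbound S (local_lipschitz (network Win bin Wout) w0 e).
Proof.
move=> e0 S; have S0 := lipschitz_bounds_neq0 Win bin Wout w0 e.
split=> [w wB|]; first by apply: lb_le_inf => // L; apply.
have w0B : cball2 w0 e w0.
  rewrite /cball2/= subrr /norm2 big1 ?sqrtr0// => i _.
  by rewrite mxE expr0n.
apply: ge_inf; exists 0 => L /(_ w0 w0B).
by apply: le_trans; exact: sqrtr_ge0.
Qed.

End LocalLipschitzMin.

(* Main.v *)
(* Write a rank-one matrix with upper left entry 1 as H = h h^T, h = (1, w, q).
   Constraint (b) of the program then says that w lies in the ball; (c) and (d)
   say that q >= 0, q - (Win w + bin) >= 0 and that these two vectors are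
   complementary, i.e. q = relu (Win w + bin); the objective is
   |Wout q - z0|^2 = |G w - G w0|^2.  Hence the rank-one feasible points are
   exactly the lifts of the inputs in the ball, and a rank-one optimum of the
   program is the lift of a worst-case input. *)
Require Import Defs.
From mathcomp Require Import all_boot all_order all_algebra.
From mathcomp Require Import boolp classical_sets reals ereal constructive_ereal.
From mathcomp Require Import lra.
Set Implicit Arguments.
Unset Strict Implicit.
Unset Printing Implicit Defensive.
Import Order.TTheory GRing.Theory Num.Theory.
Local Open Scope ring_scope.

Lemma rank1_outer (F : fieldType) p q (A : 'M[F]_(p, q)) :
  \rank A = 1%N -> exists (u : 'cV[F]_p) (v : 'rV[F]_q), A = u *m v.
Proof.
(* The inner dimension of the two factors is [\rank A], so both are generalised before it is
   rewritten to 1. *)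
move=> rA; have := mulmx_base A; move: (col_base A) (row_base A).
by rewrite rA => u v <-; exists u, v.
Qed.

(** Entries have the form [u j * v k] with [u i * v i = 1], so [A j i * A i k = A j k]; symmetry
    turns row [i] into the transpose of column [i]. *)
Lemma sym_rank1_col (F : fieldType) p (A : 'M[F]_p) i :
  A^T = A -> \rank A = 1%N -> A i i = 1 -> A = col i A *m (col i A)^T.
Proof.
move=> symA /rank1_outer[u [v Auv]].
have AE j k : A j k = u j 0 * v 0 k by rewrite Auv mxE big_ord1.
move=> Aii; apply/matrixP => j k; rewrite mxE big_ord1 !mxE.
have -> : A k i = A i k by rewrite -[in LHS]symA mxE.
have uv1 : u i 0 * v 0 i = 1 by rewrite -AE.
by rewrite !AE mulrACA [v 0 i * _]mulrC mulrACA uv1 mulr1.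
Qed.

Section Norm2.
Variable R : realType.

Lemma norm2_ge0 k (v : 'cV[R]_k) : 0 <= norm2 v.
Proof. exact: sqrtr_ge0. Qed.

Lemma sqr_norm2 k (v : 'cV[R]_k) : norm2 v ^+ 2 = \tr (v^T *m v).
Proof.
rewrite sqr_sqrtr; last by apply: sumr_ge0 => i _; exact: sqr_ge0.
by rewrite trace_mx11 mxE; apply: eq_bigr => i _; rewrite mxE expr2.
Qed.

Lemma norm2_opp k (v : 'cV[R]_k) : norm2 (- v) = norm2 v.
Proof. by congr Num.sqrt; apply: eq_bigr => i _; rewrite mxE sqrrN. Qed.

Lemma psd_outer k (v : 'cV[R]_k) : psd (v *m v^T).
Proof.
split=> [|x]; first by rewrite trmx_mul trmxK.
have -> : x^T *m (v *m v^T) *m x = (v^T *m x)^T *m (v^T *m x).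
  by rewrite trmx_mul trmxK !mulmxA.
by rewrite -trace_mx11 -sqr_norm2 sqr_ge0.
Qed.

(** A vanishing product leaves only [q i = p i] or [q i = 0], and the two sign conditions select the
    larger of [p i] and 0. *)
Lemma relu_complementarity k (p q : 'cV[R]_k) :
  q = relu p <->
  (forall i, [/\ 0 <= q i 0, 0 <= q i 0 - p i 0 & (q i 0 - p i 0) * q i 0 = 0]).
Proof.
split=> [-> i|qP].
  by rewrite mxE; case: (leP (p i 0)) => p0; split; rewrite ?subrr ?mulr0 ?mul0r//; lra.
apply/matrixP => i j; rewrite ord1 mxE.
have [q0 qp /eqP] := qP i; rewrite mulf_eq0 => /orP[|] /eqP z.
  by rewrite -[q i 0](subrK (p i 0)) z add0r max_l//; lra.
by rewrite z max_r//; lra.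
Qed.

End Norm2.

Section RankOne.
Variables (R : realType) (m n l : nat) (Win : 'M[R]_(n, m)) (bin : 'cV[R]_n).
Variables (Wout : 'M[R]_(l, n)) (w0 : 'cV[R]_m) (e : R).

(** The hidden activation [q] stays independent of the input [w]; feasibility is what ties it to
    [relu]. *)
Definition hvec (w : 'cV[R]_m) (q : 'cV[R]_n) : 'cV[R]_(1 + m + n) :=
  col_mx (col_mx 1%:M w) q.

Lemma hvec_outerE w q : hvec w q *m (hvec w q)^T =
  block_mx (block_mx 1%:M w^T w (w *m w^T)) (col_mx q^T (w *m q^T))
           (row_mx q (q *m w^T)) (q *m q^T).
Proof.
rewrite /hvec !tr_col_mx trmx1 mul_col_row mul_col_row mul_col_mx mul_mx_row.
by rewrite !mul1mx !mulmx1.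
Qed.

Lemma dual_objective_hvec w q (z0 : 'cV[R]_l) :
  dual_objective Wout z0 (hvec w q *m (hvec w q)^T) =
  norm2 (Wout *m q - z0) ^+ 2.
Proof.
(* The sign is flipped because [dual_V] pairs with the lift to give [z0 - Wout *m q]. *)
rewrite -norm2_opp opprB sqr_norm2 /dual_objective mxtrace_mulC.
have -> : z0 - Wout *m q = (dual_V m Wout z0)^T *m hvec w q.
  rewrite /dual_V /hvec !tr_col_mx !mul_row_col trmxK linearN/= trmxK trmx0.
  by rewrite mulmx1 mul0mx addr0 mulNmx.
by rewrite -mxtrace_mulC [in RHS]mxtrace_mulC trmx_mul trmxK !mulmxA.
Qed.

Lemma dual_F_hvec w q : dual_F Win bin *m hvec w q =
  col_mx (col_mx 1%:M (q - (Win *m w + bin))) q.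
Proof.
rewrite /dual_F /hvec mul_block_col mul_block_col mul_col_mx !mul1mx.
rewrite !mul0mx add_col_mx mulmx1 mulNmx !addr0 row_mx0 mul0mx add0r.
by rewrite -opprD [bin + _]addrC [- _ + q]addrC.
Qed.

(** The diagonal blocks of the product contribute [e^2 - |w0|^2 + <w0, w>] and [<w0, w> - |w|^2]. *)
Lemma ball_trace w :
  \tr (block_mx ((e ^+ 2)%:M - w0^T *m w0) w0^T w0 (- 1%:M)
       *m block_mx 1%:M w^T w (w *m w^T)) = e ^+ 2 - norm2 (w - w0) ^+ 2.
Proof.
rewrite mulmx_block mxtrace_block mulmx1 sqr_norm2 mulNmx mul1mx.
rewrite [(w - w0)^T]linearB/= mulmxBl !mulmxBr !linearB/= !linearD/= !linearN/=.
rewrite [\tr (w0 *m w^T)]mxtrace_mulC [\tr (w *m w^T)]mxtrace_mulC.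
have -> : \tr (w0^T *m w) = \tr (w^T *m w0).
  by rewrite -mxtrace_tr trmx_mul trmxK.
rewrite trace_mx11 [X in X - _]mxE eqxx mulr1n.
lra.
Qed.

Lemma dual_feasible_hvec w q : 0 <= e ->
  dual_feasible Win bin w0 e (hvec w q *m (hvec w q)^T) <->
  cball2 w0 e w /\ q = relu (Win *m w + bin).
Proof.
move=> e0; set p := Win *m w + bin.
have ball : cball2 w0 e w <-> 0 <= e ^+ 2 - norm2 (w - w0) ^+ 2.
  by rewrite subr_ge0 ler_sqr// nnegrE norm2_ge0.
have diag i : (- bin *m q^T - Win *m (w *m q^T) + q *m q^T) i i =
    (q i 0 - p i 0) * q i 0.
  rewrite mulmxA -mulmxBl -mulmxDl mxE big_ord1 !mxE; congr (_ * _).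
  lra.
have FHF : dual_F Win bin *m (hvec w q *m (hvec w q)^T) *m (dual_F Win bin)^T =
    col_mx (col_mx 1%:M (q - p)) q *m (col_mx (col_mx 1%:M (q - p)) q)^T.
  by rewrite -dual_F_hvec trmx_mul !mulmxA.
rewrite /dual_feasible/= FHF.
have -> : H11 (hvec w q *m (hvec w q)^T) = 1%:M.
  by rewrite hvec_outerE /H11 !block_mxKul.
have -> : H12 (hvec w q *m (hvec w q)^T) = w^T.
  by rewrite hvec_outerE /H12 block_mxKul block_mxKur.
have -> : H22 (hvec w q *m (hvec w q)^T) = w *m w^T.
  by rewrite hvec_outerE /H22 block_mxKul block_mxKdr.
have -> : H13 (hvec w q *m (hvec w q)^T) = q^T.
  by rewrite hvec_outerE /H13 block_mxKur col_mxKu.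
have -> : H23 (hvec w q *m (hvec w q)^T) = w *m q^T.
  by rewrite hvec_outerE /H23 block_mxKur col_mxKd.
have -> : H33 (hvec w q *m (hvec w q)^T) = q *m q^T.
  by rewrite hvec_outerE /H33 block_mxKdr.
rewrite trmxK ball_trace ball relu_complementarity.
set f := col_mx _ q.
have fM i j : (f *m f^T) i j = f i 0 * f j 0 by rewrite mxE big_ord1 [f^T _ _]mxE.
have f1 : f (lshift n (lshift n 0)) 0 = 1 by rewrite !col_mxEu mxE eqxx.
have fqp i : f (lshift n (rshift 1 i)) 0 = q i 0 - p i 0.
  by rewrite col_mxEu col_mxEd !mxE.
have fq i : f (rshift (1 + n) i) 0 = q i 0 by rewrite col_mxEd.
split=> [[_ _ -> dg pos]|[-> qp]].
  split=> // i; rewrite -diag dg; split=> //.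
    (* The leading entry of [f] is 1, so the first row of [f *m f^T] is [f^T] itself: signs of
       products become signs of [q] and of the slack [q - p]. *)
    by have := pos (lshift n (lshift n 0)) (rshift (1 + n) i); rewrite fM f1 fq mul1r.
  by have := pos (lshift n (lshift n 0)) (lshift n (rshift 1 i));
    rewrite fM f1 fqp mul1r.
have f0 i : 0 <= f i 0.
  case: (split_ordP i) => k ->; last by rewrite fq; case: (qp k).
  case: (split_ordP k) => k' ->; first by rewrite ord1 f1.
  by rewrite fqp; case: (qp k').
split=> //; [exact: psd_outer|by move=> i; rewrite diag; case: (qp i)|].
by move=> i j; rewrite fM mulr_ge0.
Qed.

End RankOne.

(** Constraint (a) normalises the leading diagonal entry, so the first column of [H] can serve as
    the lift. *)
Lemma feasible_rank1 (R : realType) m n (Win : 'M[R]_(n, m)) bin w0 e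
    (H : 'M[R]_(1 + m + n)) :
  dual_feasible Win bin w0 e H -> \rank H = 1%N ->
  exists w q, H = hvec w q *m (hvec w q)^T.
Proof.
move=> [[symH _] H11E _ _ _] rH; pose i : 'I_(1 + m + n) := lshift n (lshift m 0).
have Hii : H i i = 1.
  by have /matrixP/(_ 0 0) := H11E; rewrite !mxE eqxx.
pose h : 'cV_(1 + m + n) := col i H.
exists (dsubmx (usubmx h)), (dsubmx h).
suff <- : h = hvec (dsubmx (usubmx h)) (dsubmx h) by exact: sym_rank1_col.
rewrite /hvec -[LHS]vsubmxK -[usubmx h in LHS]vsubmxK; congr col_mx; congr col_mx.
by rewrite [LHS]mx11_scalar !mxE Hii.
Qed.

Lemma full_rank_outer (R : realType) p (h : 'cV[R]_p) :
  h != 0 -> full_rank_factorization (h *m h^T) h h^T.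
Proof.
move=> h0; have rh : \rank h = 1%N.
  by apply/eqP; rewrite eqn_leq rank_leq_col lt0n mxrank_eq0.
by split; rewrite // mxrank_tr.
Qed.

Theorem theorem4 (R : realType) (m n l : nat) (Win : 'M[R]_(n, m))
    (bin : 'cV[R]_n) (Wout : 'M[R]_(l, n)) (w0 : 'cV[R]_m) (e : R)
    (H : 'M[R]_(1 + m + n)) :
  let G := network Win bin Wout in
  let z0 := G w0 in
  let L := local_lipschitz G w0 e in
  0 < e ->
  dual_optimal Win bin Wout w0 e z0 H ->
  \rank H = 1%N ->
  L%:E = gamma_dual Win bin Wout w0 e z0 /\
  exists (h2 : 'cV[R]_m) (h3 : 'cV[R]_n),
    let h : 'cV[R]_(1 + m + n) := col_mx (col_mx 1%:M h2) h3 in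
    [/\ full_rank_factorization H h h^T,
        cball2 w0 e h2
      & L = norm2 (G h2 - G w0)].
Proof.
move=> G z0 L /ltW e0 [feasH optH] rH.
have [w [q HE]] := feasible_rank1 feasH rH.
have [wB qE] : cball2 w0 e w /\ q = relu (Win *m w + bin).
  by apply/(dual_feasible_hvec Win bin w0 _ _ e0); rewrite -HE.
have objH : dual_objective Wout z0 H = norm2 (G w - G w0) ^+ 2.
  by rewrite HE dual_objective_hvec qE.
have LE : L = norm2 (G w - G w0).
  have [Lub Llb] := local_lipschitz_min Win bin Wout w0 e0.
  apply/eqP; rewrite eq_le; apply/andP; split; last exact: Lub.
  (* Every [v] in the ball lifts to a feasible point with objective [|G v - G w0|^2], which
     optimality of [H] bounds by the value at [w]. *)
  apply: Llb => v vB; rewrite -ler_sqr ?nnegrE ?norm2_ge0// -objH.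
  rewrite -[norm2 _ ^+ 2](dual_objective_hvec _ v).
  by apply/optH/dual_feasible_hvec.
split.
  have -> : gamma_dual Win bin Wout w0 e z0 = sqrte (L ^+ 2)%:E.
    (* The supremum is attained at [H], hence finite and equal to [L ^+ 2]. *)
    congr sqrte; apply/eqP; rewrite eq_le LE -objH; apply/andP; split.
      by apply: ub_ereal_sup => _ [H' feasH' <-]; rewrite lee_fin optH.
    by apply: ereal_sup_ubound; exists H.
  by rewrite /= sqrtr_sqr ger0_norm// LE norm2_ge0.
exists w, q; split=> //; rewrite HE; apply: full_rank_outer.
(* The leading entry 1 keeps the lift from being zero. *)
apply/eqP => /matrixP/(_ (lshift n (lshift m 0)) 0).
by rewrite /hvec !col_mxEu !mxE eqxx => /eqP; rewrite oner_eq0.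
Qed.
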